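(* Let $A, B$ be closed linear operators in a complex Hilbert space $\mathbb{H}$ such that $D(A), D(B), D(A+B), D(AB)$ are dense in $\mathbb{H}$, let $n$ be a non-negative integer, and let $\epsilon> 0$. (i) If $A$ or $B$ is in $\mathcal{B}(\mathbb{H})$, then $\Lambda_{\epsilon}(A,B)= \overline{\Lambda_{\epsilon}(A^*,B^* )}$. (ii) If $A, B \in \mathcal{B}(\mathbb{H})$, then $\Lambda_{n,\epsilon}(A,B)= \overline{\Lambda_{n,\epsilon}(A^*,B^* )}$.
   Context: $\mathcal{B}(\mathbb{H})$ is the set of bounded linear operators on $\mathbb{H}$; $A^*$ denotes the Hilbert-space adjoint. For $\Omega\subseteq\mathbb{C}$, $\overline{\Omega}=\{\overline{\lambda}:\lambda\in\Omega\}$ (complex conjugation, not closure). For closed (possibly unbounded) operators $A,B$ in $\mathbb{H}$ and $\lambda\in\mathbb{C}$, the pencil $\lambda B-A$ is defined on $D(A)\cap D(B)$. The generalized resolvent set is $\rho(A,B)=\{\lambda\in\mathbb{C}: (\lambda B-A)^{-1}\in\mathcal{B}(\mathbb{H})\}$ and $\sigma(A,B)=\mathbb{C}\setminus\rho(A,B)$. The $(n,\epsilon)$-pseudospectrum is $$\Lambda_{n,\epsilon}(A,B)=\sigma(A,B)\cup\left\{\lambda\in\mathbb{C}: \left\|(\lambda B-A)^{-2^n}\right\|^{1/2^n}\ge \epsilon^{-1}\right\},$$ and $\Lambda_\epsilon(A,B)=\Lambda_{0,\epsilon}(A,B)$. *)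

(* Defs.v *)
From HB Require Import structures.
From mathcomp Require Import all_boot all_order all_algebra.
From mathcomp Require Import all_classical all_reals all_analysis.
From mathcomp Require Export complex.
Export numFieldNormedType.Exports.

Set Implicit Arguments.
Unset Strict Implicit.
Unset Printing Implicit Defensive.

Import Order.TTheory GRing.Theory Num.Theory.

Local Open Scope classical_set_scope.
Local Open Scope ring_scope.

(* An operator in H: only the values of [app] on [dom] are meaningful, and
   every predicate and construction below looks at those values only. *)
Record operator (H : Type) := Operator { dom : set H; app :> H -> H }.

Section Operators.
Variables (R : realType) (H : completeNormedModType R[i]).
Implicit Types (A B T : operator H) (lambda : R[i]).

(* The norm of H takes values in R[i]; it is read here in R. *)
Definition normR (x : H) : R := complex.Re `|x|.

Definition linear_op A :=
  [/\ dom A 0,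
      forall a x y, dom A x -> dom A y -> dom A (a *: x + y) &
      forall a x y, dom A x -> dom A y -> A (a *: x + y) = a *: A x + A y].

Definition closed_op A :=
  closed [set p : H * H | dom A p.1 /\ A p.1 = p.2].

Definition bounded_op A :=
  [/\ dom A = [set: H], linear_op A &
      exists M : R, forall x, normR (A x) <= M * normR x].

Definition op_id : operator H := Operator [set: H] id.

Definition op_add A B : operator H :=
  Operator (dom A `&` dom B) (fun x => A x + B x).

Definition op_comp A B : operator H :=
  Operator [set x | dom B x /\ dom A (B x)] (fun x => A (B x)).

Definition op_exp T k : operator H := iter k (op_comp T) op_id.

(* For lambda = 0 the domain is still D(A) `&` D(B). *)
Definition pencil A B lambda : operator H :=
  Operator (dom A `&` dom B) (fun x => lambda *: B x - A x).

(* The inverse of T, meaningful when T is injective on its domain. *)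
Definition op_inv T : operator H :=
  Operator (T @` dom T) (fun y => xget 0 [set x | dom T x /\ T x = y]).

(* The adjoint for the inner product ip: D(A^* ) is the set of the y for which
   some z satisfies <A x, y> = <x, z> for all x in D(A), and A^* y = z. This z
   is unique when D(A) is dense. *)
Definition adjoint (ip : H -> H -> R[i]) A : operator H :=
  let rel y z := forall x, dom A x -> ip (A x) y = ip x z in
  Operator [set y | exists z, rel y z] (fun y => xget 0 [set z | rel y z]).

Definition opnorm T : R :=
  sup [set normR (T x) | x in dom T `&` [set x | normR x <= 1]].

Definition resolvent_set A B : set R[i] :=
  [set lambda | set_inj (dom (pencil A B lambda)) (pencil A B lambda) /\
                bounded_op (op_inv (pencil A B lambda))].

Definition spectrum A B : set R[i] := ~` resolvent_set A B.

(* The second set is only relevant at points of the resolvent set, where the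
   operator whose norm is taken is an everywhere defined bounded operator. *)
Definition pseudospectrum_n (n : nat) (epsilon : R) A B : set R[i] :=
  spectrum A B `|`
  [set lambda | epsilon^-1 <=
     opnorm (op_exp (op_inv (pencil A B lambda)) (2 ^ n)%N)
       `^ ((2 ^ n)%N%:R^-1)].

Definition pseudospectrum (epsilon : R) A B : set R[i] :=
  pseudospectrum_n 0 epsilon A B.

End Operators.

Definition conj_set (R : realType) (Omega : set R[i]) : set R[i] :=
  [set lambda^* | lambda in Omega].

(* Main.v *)
Require Import Defs.
From HB Require Import structures.
From mathcomp Require Import all_boot all_order all_algebra.
From mathcomp Require Import all_classical all_reals all_analysis.
From mathcomp Require Import ring lra.
Import Order.TTheory GRing.Theory Num.Theory.
Local Open Scope classical_set_scope.
Local Open Scope ring_scope.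

(** Write T for the pencil lambda B - A, and A', B', T' for adjoints.  If T is
    densely defined and closed and T' = conj(lambda) B' - A', then T has a
    bounded everywhere defined inverse S if and only if T' has one, S', and
    <S x, y> = <x, S' y> for all x and y ([inv_bounded_adjoint],
    [is_adjoint_inv_bounded]).  All powers of S and S' are then adjoint to each
    other, hence have the same norm ([opnorm_exp_total_adjoint]).  So lambda
    and conj(lambda) are in the two pseudospectra at the same time, for every
    order n, as soon as one of A and B is bounded; both parts are instances of
    this ([pseudospectrum_adjoint]).

    The pencil is closed with the adjoint just given when B is bounded, and
    also when A is bounded and lambda is not 0.  The remaining case is A
    bounded and lambda = 0, where the pencil is -A restricted to D(B), which
    need not be closed and whose adjoint need not be -A' restricted to D(B').
    There, if one of the two pencils has a bounded inverse, then D(B) or D(B')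
    is closed, because the pencil and its inverse are both bounded
    ([inv_bounded_seq_closed_dom]); being dense, it is all of H, and the closed
    graph theorem makes B bounded ([bounded_of_full_dom]), which brings the
    situation back to the first case ([pencil_inv_bounded]).

    Two theorems on Hilbert spaces carry these arguments.  The Riesz
    representation theorem on a complete subspace ([riesz_representation])
    gives the adjoint of a bounded operator, the fact that a closed range with
    trivial orthogonal complement is everything, and, applied to the graph of
    B, the density of D(B').  The uniform boundedness principle
    ([weakly_bounded_bounded]) gives the closed graph theorem, by applying it
    to the image of the unit ball of D(B) or of D(B').

    Metric arguments only use the real part of the inner product, which is a
    real symmetric positive form with the same norm. *)

Set Implicit Arguments.
Unset Strict Implicit.
Unset Printing Implicit Defensive.

(** * Real positive forms and the Riesz representation theorem *)

Section RealForm.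
Local Open Scope complex_scope.
Variables (R : realType) (V : lmodType R[i]).
Implicit Types (g : V -> V -> R) (D : set V) (u : nat -> V) (x y z : V).

(** Only real scalars appear, so that the real part of a Hermitian form
    qualifies. *)
Definition real_form g :=
  [/\ forall x y, g x y = g y x,
      forall (a : R) x y z, g (a%:C *: x + y) z = a * g x z + g y z &
      forall x, 0 <= g x x].

Definition real_subspace D :=
  D 0 /\ forall (a : R) x y, D x -> D y -> D (a%:C *: x + y).

Definition tends g u x :=
  forall e : R, 0 < e ->
    exists N, forall n, (N <= n)%N -> g (u n - x) (u n - x) < e.

Definition cauchy_for g u :=
  forall e : R, 0 < e -> exists N, forall m n, (N <= m)%N -> (N <= n)%N ->
    g (u m - u n) (u m - u n) < e.

Definition complete_for g D :=
  forall u, (forall n, D (u n)) -> cauchy_for g u -> exists2 x, D x & tends g u x.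

Section Form.
Variables (g : V -> V -> R) (gP : real_form g).

Lemma form_sym x y : g x y = g y x. Proof. by case: gP. Qed.
Lemma form_ge0 x : 0 <= g x x. Proof. by case: gP. Qed.
Lemma rformPl (a : R) x y z : g (a%:C *: x + y) z = a * g x z + g y z.
Proof. by case: gP. Qed.
Lemma rformDl x y z : g (x + y) z = g x z + g y z.
Proof. by rewrite -[x in LHS]scale1r (rformPl 1) mul1r. Qed.
Lemma rform0l z : g 0 z = 0.
Proof. by have := rformDl 0 0 z; rewrite addr0 => h; lra. Qed.
Lemma rformZl (a : R) x z : g (a%:C *: x) z = a * g x z.
Proof. by rewrite -[_ *: _]addr0 rformPl rform0l addr0. Qed.
Lemma rformNl x z : g (- x) z = - g x z.
Proof. by apply/eqP; rewrite -addr_eq0 -rformDl addNr rform0l. Qed.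
Lemma rformDr x y z : g z (x + y) = g z x + g z y.
Proof. by rewrite !(form_sym z) rformDl. Qed.
Lemma rformZr (a : R) x z : g z (a%:C *: x) = a * g z x.
Proof. by rewrite !(form_sym z) rformZl. Qed.
Lemma rformNr x z : g z (- x) = - g z x.
Proof. by rewrite !(form_sym z) rformNl. Qed.

Definition rformE := (rformDl, rformDr, rformZl, rformZr, rformNl, rformNr).

(** Cauchy-Schwarz.  The square of [g q q *: p - g p q *: q] gives the inequality
    multiplied by [g q q]; when both squares vanish, positivity of x + y and
    x - y forces [g x y] to be 0. *)
Lemma form_CS x y : g x y ^+ 2 <= g x x * g y y.
Proof.
have key p q : 0 <= g q q * (g p p * g q q - g p q ^+ 2).
  have := form_ge0 ((g q q)%:C *: p - (g p q)%:C *: q).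
  by rewrite !rformE (form_sym q p); nra.
have [cy|cy] := ltrP 0 (g y y).
  by rewrite -subr_ge0 -(pmulr_rge0 _ cy); exact: key.
have [cx|cx] := ltrP 0 (g x x).
  by rewrite form_sym mulrC -subr_ge0 -(pmulr_rge0 _ cx); exact: key.
have := form_ge0 (x + y); have := form_ge0 (x - y).
rewrite !rformE (form_sym y x); have := form_ge0 x; have := form_ge0 y.
by move=> *; nra.
Qed.

Lemma tends_cauchy u x : tends g u x -> cauchy_for g u.
Proof.
move=> ux e e0; have [N HN] := ux (e / 4) ltac:(lra).
exists N => m n /HN hm /HN hn.
have -> : u m - u n = (u m - x) - (u n - x) by rewrite opprB addrA subrK.
have := form_ge0 ((u m - x) + (u n - x)).
move: (u m - x) (u n - x) hm hn => a b.
rewrite !rformE (form_sym b a).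
by move=> *; lra.
Qed.

End Form.

(** Dirichlet's principle: the representing vector minimises
    J x = g x x - 2 l x on D.  The bound on [l] keeps J bounded below, and the
    parallelogram law, read at the midpoint of two almost minimisers, makes any
    minimising sequence Cauchy.  For a functional with [l x <= C * sqrt (g x x)]
    the bound holds with M = C ^ 2. *)
Lemma riesz_representation g D (l : V -> R) (M : R) :
  real_form g -> real_subspace D ->
  complete_for g D ->
  (forall (a : R) x y, D x -> D y -> l (a%:C *: x + y) = a * l x + l y) ->
  (forall x, D x -> 2 * l x <= M + g x x) ->
  exists2 x, D x & forall w, D w -> l w = g w x.
Proof.
move=> gP [D0 DP] cD lP lM.
pose J x := g x x - 2 * l x.
have lbJ : has_inf (J @` D).
  split; first by exists (J 0), 0.
  by exists (- M) => _ [x Dx <-]; have := lM x Dx; rewrite /J => h; lra.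
set m := inf (J @` D).
have Jm x : D x -> m <= J x.
  by move=> Dx; apply: ge_inf; [case: lbJ | exists x].
have /choice [u uP] (n : nat) : exists x, D x /\ J x < m + n.+1%:R^-1.
  have n0 : 0 < n.+1%:R^-1 :> R by rewrite invr_gt0.
  have [_ [x Dx <-] xm] := inf_adherent n0 lbJ.
  by exists x.
have small (e : R) : 0 < e -> exists N, forall n, (N <= n)%N -> J (u n) < m + e.
  move=> e0; exists (Num.trunc e^-1) => n Nn; apply: (lt_le_trans (uP n).2).
  rewrite lerD2l -[leRHS]invrK lef_pV2 ?posrE ?invr_gt0 //.
  apply: ltW; apply: (lt_le_trans (truncnS_gt _)).
  by rewrite ler_nat ltnS.
have D2 x y : D x -> D y -> D ((2^-1)%:C *: x + (2^-1)%:C *: y).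
  by move=> Dx Dy; apply: (DP) => //; rewrite -[_ *: y]addr0; exact: DP.
have l0 : l 0 = 0 by have := lP 1 0 0 D0 D0; rewrite scaler0 addr0 => h; lra.
have l2 x y : D x -> D y -> l ((2^-1)%:C *: x + (2^-1)%:C *: y) = (l x + l y) / 2.
  move=> Dx Dy; rewrite lP //; last by rewrite -[_ *: y]addr0; exact: DP.
  by rewrite -[_ *: y]addr0 lP // l0; lra.
have cu : cauchy_for g u.
  move=> e e0; have [N HN] := small (e / 4) ltac:(lra).
  exists N => p q /HN up /HN uq.
  have [Dp _] := uP p; have [Dq _] := uP q.
  have := Jm _ (D2 _ _ Dp Dq).
  move: up uq; rewrite /J l2 // !rformE // (form_sym gP (u q) (u p)).
  by move=> *; lra.
have [x Dx ux] := cD u (fun n => (uP n).1) cu.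
exists x => // w Dw.
pose c := g w w; pose b := g w x - l w.
(* First variation in the direction w.  It is taken at a point v = u n of the
   minimising sequence; replacing v by x costs 2 g (v - x) (s w), which positivity
   on v - x - s w bounds and which is where the factor 2 before s ^ 2 comes
   from. *)
have main (s : R) : 0 <= 2 * s ^+ 2 * c + 2 * s * b.
  apply/ler_addgt0Pr => e e0.
  have [N1 /(_ (maxn N1 _) (leq_maxl _ _)) H1] := ux (e / 2) ltac:(lra).
  have [N2 /(_ (maxn _ N2) (leq_maxr _ _)) H2] := small (e / 2) ltac:(lra).
  move: (H1 N2) (H2 N1); set v := u _ => {}H1 {}H2.
  have Dv : D v by exact: (uP _).1.
  have h3 := Jm _ (DP s _ _ Dw Dv).
  have h4 := form_ge0 gP (v - x - s%:C *: w).
  move: H1 H2 h3 h4; rewrite /J lP // !rformE // /b /c.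
  rewrite (form_sym gP x v) (form_sym gP v w) (form_sym gP x w).
  by move=> *; lra.
have c0 : 0 <= c by exact: form_ge0.
suff : b = 0 by rewrite /b => /eqP; rewrite subr_eq0 => /eqP.
(* This step makes the right-hand side -2 (b / (c + 1)) ^ 2, also if c = 0. *)
have := main (- b / (c + 1)).
have c1 : 0 < c + 1 by lra.
have -> : 2 * (- b / (c + 1)) ^+ 2 * c + 2 * (- b / (c + 1)) * b =
  - (2 * (b / (c + 1)) ^+ 2) by field; lra.
rewrite oppr_ge0 pmulr_rle0 // => h.
have /eqP : (b / (c + 1)) ^+ 2 = 0 by apply/eqP; rewrite eq_le h sqr_ge0.
rewrite sqrf_eq0 mulf_eq0 invr_eq0 (gt_eqF c1) orbF.
by move/eqP.
Qed.

End RealForm.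

(** * Real part of the inner product, and uniform boundedness *)

Section HilbertBasics.
Local Open Scope complex_scope.
Variables (R : realType) (H : completeNormedModType R[i]).
Variable ip : {dot H for @Num.conj R[i]}.
Hypothesis ip_norm : forall x : H, `|x| ^+ 2 = ip x x.
Implicit Types (x y z : H) (D : set H) (u : nat -> H) (A : operator H).

Lemma normRE x : `|x| = (normR x)%:C.
Proof. by rewrite /normR RRe_real // ger0_real. Qed.

Lemma normR_ge0 x : 0 <= normR x.
Proof. by rewrite -ler0c -normRE. Qed.

Lemma ipC x y : ip y x = (ip x y)^*.
Proof. by rewrite hermC /= expr0 mul1r. Qed.

Definition re_ip x y : R := complex.Re (ip x y).
Local Notation rip := re_ip.

Lemma rip_norm x : rip x x = normR x ^+ 2.
Proof. by rewrite /re_ip -ip_norm normRE -rmorphXn. Qed.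

Lemma rip_form : real_form rip.
Proof.
split => [x y|a x y z|x]; last by rewrite rip_norm sqr_ge0.
- by rewrite /re_ip ipC; case: (ip _ _).
- rewrite /re_ip linearDl linearZl_LR /=.
  by case: (ip x z) => b c; case: (ip y z) => d e /=; rewrite mul0r subr0.
Qed.

Let ripE := rformE rip_form.

Lemma rip_le x y : rip x y <= normR x * normR y.
Proof.
have [->|h] := eqVneq (rip x y) 0; first by rewrite mulr_ge0 ?normR_ge0.
have := form_CS rip_form x y; rewrite !rip_norm -exprMn.
have := normR_ge0 x; have := normR_ge0 y => y0 x0.
rewrite -ler_sqrt ?sqr_ge0 // !sqrtr_sqr [`|_ * _|]ger0_norm ?mulr_ge0 //.
by apply: le_trans; exact: ler_norm.
Qed.

Lemma normR_eq0 x : normR x = 0 -> x = 0.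
Proof. by move=> h; apply/eqP; rewrite -normr_eq0 normRE h. Qed.

Lemma normR_tri x y : normR (x + y) <= normR x + normR y.
Proof.
by rewrite -lecR rmorphD /= -!normRE ler_normD.
Qed.

(** Dividing by [M ^+ 2 + 1] rather than [M ^+ 2] covers M = 0. *)
Lemma rip_lt_of_normR_le (M e : R) x y : normR x <= M * normR y ->
  rip y y < e / (M ^+ 2 + 1) -> rip x x < e.
Proof.
have M1 : 0 < M ^+ 2 + 1 by rewrite ltr_wpDl // sqr_ge0.
rewrite !rip_norm ltr_pdivlMr //.
have := normR_ge0 x; set p := normR x; set q := normR y => p0 pq.
have : p ^+ 2 <= (M * q) ^+ 2 by rewrite ler_pXn2r // nnegrE (le_trans p0).
by rewrite exprMn => h; have := sqr_ge0 q; nra.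
Qed.

Lemma div_sqrD1_gt0 (M e : R) : 0 < e -> 0 < e / (M ^+ 2 + 1).
Proof. by move=> e0; rewrite divr_gt0 // ltr_wpDl // sqr_ge0. Qed.

Lemma normRZ (a : R) x : 0 <= a -> normR (a%:C *: x) = a * normR x.
Proof.
move=> a0; apply: complexI; rewrite rmorphM /= -!normRE normrZ.
by rewrite [`|a%:C|]ger0_norm // ler0c.
Qed.

(** A complex linear functional is determined by its real part: the imaginary part
    at x is minus the real part at ix. *)
Lemma ip_of_rip (l : H -> R[i]) D y : (forall x, D x -> D ('i *: x)) ->
  (forall x, D x -> l ('i *: x) = 'i * l x) ->
  (forall x, D x -> complex.Re (l x) = rip x y) ->
  forall x, D x -> l x = ip x y.
Proof.
move=> Di li lr x Dx; have := lr _ (Di _ Dx); have := lr _ Dx.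
rewrite /re_ip li // linearZl_LR /=.
case: (l x) => a b; case: (ip x y) => c d /=.
by rewrite !mul0r !sub0r !mul1r => -> /oppr_inj ->.
Qed.

Lemma ip_inj y z : (forall x, ip x y = ip x z) -> y = z.
Proof.
move=> h; apply/eqP; rewrite -subr_eq0 -(dnorm_eq0 ip); apply/eqP.
by rewrite linearBr /= h subrr.
Qed.

Lemma tends_cvg u x : tends rip u x -> u @ \oo --> x.
Proof.
move=> ux; apply/cvgrPdist_lt => e e0.
have er : e = (complex.Re e)%:C by rewrite RRe_real // gtr0_real.
move: e0; rewrite er ltcR => e0.
have [N HN] := ux (complex.Re e ^+ 2) (exprn_gt0 _ e0).
exists N => // n /= /HN; rewrite rip_norm => h.
rewrite distrC normRE ltcR.
by rewrite -(@ltr_pXn2r _ 2) // nnegrE ?normR_ge0 // ltW.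
Qed.

Lemma cvg_tends u x : u @ \oo --> x -> tends rip u x.
Proof.
move=> ux e e0; have s0 : 0 < (Num.sqrt e)%:C by rewrite ltcR sqrtr_gt0.
have /cvgrPdist_lt /(_ _ s0) [N _ HN] := ux.
exists N => n /HN; rewrite distrC normRE ltcR rip_norm => h.
rewrite -[ltRHS]sqr_sqrtr ?ltW //.
by rewrite ltr_pXn2r // nnegrE ?normR_ge0 ?sqrtr_ge0.
Qed.

Lemma complete_setT : complete_for rip setT.
Proof.
move=> u _ cu.
have /cvg_ex [x ux] : cvg (u @ \oo).
  apply/cauchy_cvgP; apply: cauchy_exP => e e0.
  have er : e = (complex.Re e)%:C by rewrite RRe_real // gtr0_real.
  move: e0; rewrite er ltcR => e0.
  have [N HN] := cu (complex.Re e ^+ 2) (exprn_gt0 _ e0).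
  exists (u N); exists N => // n /= Nn; rewrite -ball_normE /= normRE ltcR.
  have := HN N n (leqnn _) Nn; rewrite rip_norm => h.
  by rewrite -(@ltr_pXn2r _ 2) // nnegrE ?normR_ge0 // ltW.
by exists x => //; exact: cvg_tends.
Qed.

Definition seq_closed D :=
  forall u x, (forall n, D (u n)) -> tends rip u x -> D x.

Lemma complete_seq_closed D : seq_closed D -> complete_for rip D.
Proof.
move=> cD u Du /(complete_setT (fun=> I)) [x _ ux].
by exists x => //; exact: cD ux.
Qed.

Definition seq_closed_op A := forall u x y, (forall n, dom A (u n)) ->
  tends rip u x -> tends rip (A \o u) y -> dom A x /\ A x = y.

Lemma closed_seq_closed_op A : closed_op A -> seq_closed_op A.
Proof.
move=> cA u x y Au /tends_cvg ux /tends_cvg uy.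
apply: (closed_cvg (u_ := fun n => (u n, A (u n))) _ cA _ (x, y) (cvg_pair ux uy)).
by apply: nearW => n /=; rewrite /mkset; split.
Qed.

(** Otherwise some x in D lies in the ball of radius |y| at y, and then
    |y| ^ 2 = <y - x, y> < |y| ^ 2. *)
Lemma dense_orth D y : dense D -> (forall x, D x -> rip x y = 0) -> y = 0.
Proof.
move=> dD Dy; apply: normR_eq0; apply/eqP; apply/contraT => y0.
have {}y0 : 0 < normR y by rewrite lt_def y0 normR_ge0.
have yc : 0 < (normR y)%:C by rewrite ltcR.
have bn : ball y (normR y)%:C !=set0 by exists y; exact: ballxx.
have := dD _ bn (ball_open _ _).
move=> [x [yx Dx]]; move: yx; rewrite -ball_normE /= normRE ltcR => h.
have := rip_le (y - x) y; rewrite !ripE (Dy x Dx) rip_norm.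
by nra.
Qed.

(** For z <> 0, one of x + c z and x - c z with c = r / |z| works, according to the
    sign of <x, z>. *)
Lemma ubp_step (r : R) x z : 0 <= r ->
  exists y, normR (y - x) <= r /\ r * normR z <= `|rip y z|.
Proof.
move=> r0; have [z0|z0] := eqVneq (normR z) 0.
  exists x; rewrite subrr z0 mulr0; split=> //.
  by rewrite /normR normr0.
have zp : 0 < normR z by rewrite lt_def z0 normR_ge0.
pose c := r / normR z.
have c0 : 0 <= c by rewrite divr_ge0 // ltW.
have cz : normR (c%:C *: z) = r by rewrite normRZ // divfK.
have rz : rip (c%:C *: z) z = r * normR z.
  by rewrite !ripE rip_norm expr2 mulrA divfK.
have p0 : 0 <= r * normR z by rewrite mulr_ge0 // ltW.
have [xz|xz] := lerP 0 (rip x z).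
  exists (x + c%:C *: z); rewrite addrC addKr cz; split=> //.
  by rewrite (rformDl rip_form) rz ger0_norm; lra.
exists (x - c%:C *: z); rewrite addrC addKr; split.
  by rewrite /normR normrN -/(normR _) cz.
by rewrite (rformDl rip_form) (rformNl rip_form) rz ltr0_norm; lra.
Qed.

(** Uniform boundedness by a gliding hump.  If S is
    unbounded, pick s n in S with norm at least n 3 ^ (n + 1), and move from
    u n to u (n + 1) by a step of length at most 3 ^ - (n + 1) that makes the
    product with s n at least 3 ^ - (n + 1) |s n|.  All later steps together
    have half the length of that one, so at the limit x the product with s n
    is still at least n / 2 in absolute value. *)
Lemma weakly_bounded_bounded (S : set H) :
  (forall x, exists M : R, forall s, S s -> rip x s <= M) ->
  exists M : R, forall s, S s -> normR s <= M.
Proof.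
move=> wb; apply: contrapT => nb.
pose r n : R := (3^-1) ^+ n.
have r0 n : 0 < r n by rewrite exprn_gt0 // invr_gt0.
have /choice [s sP] (n : nat) : exists s, S s /\ n%:R < r n.+1 * normR s.
  apply: contrapT => ns; apply: nb; exists (n%:R / r n.+1) => z Sz.
  rewrite leNgt; apply/negP => nz; apply: ns; exists z; split=> //.
  by rewrite mulrC -ltr_pdivrMr.
have /choice [f fP] (nx : nat * H) : exists y,
    normR (y - nx.2) <= r nx.1.+1 /\ r nx.1.+1 * normR (s nx.1) <= `|rip y (s nx.1)|.
  exact/ubp_step/ltW.
pose u := fix u n := if n is k.+1 then f (k, u k) else 0.
have us n : r n.+1 * normR (s n) <= `|rip (u n.+1) (s n)|.
  exact: (fP (n, u n)).2.
have rS n : r n.+1 = r n / 3 by rewrite /r exprSr.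
have du n k : normR (u (n + k)%N - u n) <= (r n - r (n + k)%N) / 2.
  elim: k => [|k IH]; first by rewrite addn0 !subrr mul0r /normR normr0.
  have h := (fP ((n + k)%N, u (n + k)%N)).1; rewrite /= in h.
  have := normR_tri (u (n + k.+1)%N - u (n + k)%N) (u (n + k)%N - u n).
  rewrite addrA subrK addnS [u _.+1]/= => h2.
  apply: (le_trans h2); apply: (le_trans (lerD h IH)).
  by rewrite rS; lra.
have {}du n m : (n <= m)%N -> normR (u m - u n) <= r n / 2.
  move=> nm; have := du n (m - n)%N; rewrite subnKC // => h.
  by apply: (le_trans h); have := r0 m; lra.
have rl n : r n <= n.+1%:R^-1.
  rewrite /r exprVn lef_pV2 ?posrE ?exprn_gt0 // -natrX ler_nat.
  by rewrite ltn_expl.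
have rsmall (e : R) : 0 < e -> exists N, r N < e.
  move=> e0; exists (Num.trunc e^-1); apply: (le_lt_trans (rl _)).
  by rewrite -[ltRHS]invrK ltf_pV2 ?posrE ?invr_gt0 // truncnS_gt.
have cu : cauchy_for rip u.
  move=> e e0; have [N HN] := rsmall (Num.sqrt e) ltac:(by rewrite sqrtr_gt0).
  exists N => m n Nm Nn; rewrite rip_norm -[ltRHS]sqr_sqrtr ?ltW //.
  rewrite ltr_pXn2r // ?nnegrE ?normR_ge0 ?sqrtr_ge0 //.
  have := normR_tri (u m - u N) (u N - u n); rewrite addrA subrK => h.
  have h1 := du _ _ Nm; have := du _ _ Nn; rewrite /normR distrC => h2.
  by apply: (le_lt_trans h); rewrite /normR in h1 *; lra.
have [x _ ux] := complete_setT (fun=> I) cu.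
have xu n : normR (x - u n) <= r n / 2.
  apply/ler_addgt0Pr => e e0; have [N HN] := ux _ (exprn_gt0 2 e0).
  have := HN _ (leq_maxl N n); set p := maxn N n => h.
  have := normR_tri (x - u p) (u p - u n); rewrite addrA subrK => h2.
  have h3 := du _ _ (leq_maxr N n).
  apply: (le_trans h2); rewrite addrC; apply: lerD => //.
  rewrite /normR distrC -/(normR _); rewrite rip_norm in h.
  by rewrite -(@ler_pXn2r _ 2) ?nnegrE ?normR_ge0 // ltW.
(* The hypothesis is one-sided, so a bound on the absolute value needs -x too. *)
have [M1 HM1] := wb x; have [M2 HM2] := wb (- x).
have key n : n%:R / 2 < `|M1| + `|M2|.
  have [Ss sn] := sP n.
  have a1 := HM1 _ Ss; have := HM2 _ Ss; rewrite (rformNl rip_form) => a2.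
  have b1 := ler_norm M1; have b2 := ler_norm M2.
  have b3 := normr_ge0 M1; have b4 := normr_ge0 M2.
  have h : `|rip x (s n)| <= `|M1| + `|M2| by rewrite ler_norml; lra.
  apply: lt_le_trans h.
  have c1 := rip_le (x - u n.+1) (s n); have c2 := rip_le (u n.+1 - x) (s n).
  have d : normR (u n.+1 - x) = normR (x - u n.+1) by rewrite /normR distrC.
  have c3 : normR (x - u n.+1) * normR (s n) <= r n.+1 / 2 * normR (s n).
    by apply: ler_wpM2r; [exact: normR_ge0 | exact: xu].
  have c4 := us n; move: c1 c2; rewrite d !ripE => c1 c2.
  move: c4; have [c5|c5] := lerP 0 (rip (u n.+1) (s n)).
    by rewrite (ger0_norm c5) => c4; apply: lt_le_trans (ler_norm _); lra.
  rewrite (ltr0_norm c5) -(normrN (rip x _)) => c4.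
  by apply: lt_le_trans (ler_norm _); lra.
have := key (Num.trunc (2 * (`|M1| + `|M2|))).+1.
have := truncnS_gt (2 * (`|M1| + `|M2|)).
by lra.
Qed.

End HilbertBasics.

(** * Adjoints and bounded inverses *)

Section Adjoints.
Local Open Scope complex_scope.
Variables (R : realType) (H : completeNormedModType R[i]).
Variable ip : {dot H for @Num.conj R[i]}.
Hypothesis ip_norm : forall x : H, `|x| ^+ 2 = ip x x.
Implicit Types (x y z : H) (D : set H) (u : nat -> H) (A T : operator H).

Local Notation rip := (re_ip ip).
Let ripP : real_form rip := rip_form ip_norm.
Let ripE := rformE ripP.

Lemma linear_opD T x y : linear_op T -> dom T x -> dom T y ->
  dom T (x + y) /\ T (x + y) = T x + T y.
Proof.
case=> _ h1 h2 Tx Ty; rewrite -[x in x + y]scale1r; split; first exact: h1.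
by rewrite h2 // scale1r.
Qed.

Lemma linear_op0 T : linear_op T -> dom T 0 /\ T 0 = 0.
Proof.
move=> lT; case: (lT) => T0 _ _; split=> //.
have [_] := linear_opD lT T0 T0; rewrite addr0 => /eqP.
by rewrite -subr_eq subrr eq_sym => /eqP.
Qed.

Lemma linear_opZ T a x : linear_op T -> dom T x ->
  dom T (a *: x) /\ T (a *: x) = a *: T x.
Proof.
move=> lT Tx; have [T0 e0] := linear_op0 lT; case: (lT) => _ h1 h2.
rewrite -[a *: x]addr0; split; first exact: h1.
by rewrite h2 // e0 addr0.
Qed.

Lemma linear_opB T x y : linear_op T -> dom T x -> dom T y ->
  dom T (x - y) /\ T (x - y) = T x - T y.
Proof.
move=> lT Tx Ty; have [Ny eN] := linear_opZ (-1) lT Ty.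
by have := linear_opD lT Tx Ny; rewrite eN !scaleN1r.
Qed.

(** A characterisation of the values of the adjoint that leaves out what it does
    outside its domain.  The implication from right to left contains the
    maximality of the domain of the adjoint. *)
Definition is_adjoint T T' := forall y z,
  (dom T' y /\ T' y = z) <-> forall x, dom T x -> ip (T x) y = ip x z.

Lemma is_adjoint_ip T T' x y : is_adjoint T T' -> dom T x -> dom T' y ->
  ip (T x) y = ip x (T' y).
Proof. by move=> ad Tx Ty; apply: (ad y (T' y)).1. Qed.

Lemma adjointP A : dense (dom A) -> is_adjoint A (adjoint ip A).
Proof.
move=> dA y z; rewrite /adjoint /=.
set P := fun z => _.
have uniq z1 z2 : P z1 -> P z2 -> z1 = z2.
  move=> p1 p2; apply/eqP; rewrite -subr_eq0; apply/eqP.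
  apply: (dense_orth ip_norm dA) => x Ax.
  by rewrite /re_ip linearBr /= -p1 // -p2 // subrr.
split=> [[ex <-]|Pz]; first exact: (xgetPex 0 ex).
split; first by exists z.
apply: (uniq _ _ _ Pz); apply: (xgetPex 0 (ex_intro _ z Pz)).
Qed.

Lemma is_adjoint_linear T T' : is_adjoint T T' -> linear_op T'.
Proof.
move=> ad; have lin a x y : dom T' x -> dom T' y ->
    dom T' (a *: x + y) /\ T' (a *: x + y) = a *: T' x + T' y.
  move=> Tx Ty; apply/ad => w Tw.
  rewrite !linearDr !linearZr_LR /= !(is_adjoint_ip ad) //.
split; first by apply: ((ad 0 0).2 _).1 => x _; rewrite !linear0r.
- by move=> a x y Tx Ty; exact: (lin a x y Tx Ty).1.
- by move=> a x y Tx Ty; exact: (lin a x y Tx Ty).2.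
Qed.

Lemma is_adjoint_rip T T' y z : linear_op T -> is_adjoint T T' ->
  (forall x, dom T x -> rip (T x) y = rip x z) -> dom T' y /\ T' y = z.
Proof.
move=> lT ad h; apply/ad; apply: ip_of_rip => // x Tx.
- exact: (linear_opZ _ lT Tx).1.
- by rewrite (linear_opZ _ lT Tx).2 linearZl_LR.
Qed.

(** Orthogonal projection onto a closed subspace, as the vector that represents
    the functional x |-> <x, z> on it. *)
Lemma riesz_closed D z : (forall (a : R[i]) x y, D x -> D y -> D (a *: x + y)) ->
  D 0 -> seq_closed ip D -> exists2 w, D w & forall x, D x -> rip x z = rip x w.
Proof.
move=> DP D0 cD.
apply: (riesz_representation (M := rip z z) ripP _ (complete_seq_closed ip_norm cD)).
- by split=> // a x y; exact: DP.
- by move=> a x y _ _; rewrite !ripE.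
- move=> x _; have := form_ge0 ripP (x - z).
  by rewrite !ripE (form_sym ripP z x) => h; lra.
Qed.

(** The vector z represents the bounded functional x |-> <A x, y>. *)
Lemma bounded_adjoint A y : bounded_op A -> exists z, forall x, ip (A x) y = ip x z.
Proof.
move=> [dA lA [M AM]].
have AT x : dom A x by rewrite dA.
have [_ _ lA2] := lA.
have [z _ h] : exists2 z, setT z & forall x, setT x -> rip (A x) y = rip x z.
  apply: (riesz_representation (M := (M * normR y) ^+ 2) ripP _
    (complete_setT ip_norm)).
  - by [].
  - by move=> a x1 x2 _ _; rewrite lA2 // !ripE.
  - move=> x _; have := rip_le ip_norm (A x) y; have := AM x.
    have := normR_ge0 x; have := normR_ge0 y; rewrite rip_norm //.
    move=> y0 x0 h1 h2; have := ler_wpM2r y0 h1 => h3.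
    have := sqr_ge0 (M * normR y - normR x); nra.
exists z => x; apply: (@ip_of_rip _ _ ip (fun x => ip (A x) y) setT) => //.
by move=> w _; rewrite (linear_opZ _ lA (AT w)).2 linearZl_LR.
Qed.

(** lambda is in the resolvent set exactly when the pencil satisfies this. *)
Definition inv_bounded T := set_inj (dom T) T /\ bounded_op (op_inv T).

Lemma op_invP T y : (exists2 x, dom T x & T x = y) ->
  dom T (op_inv T y) /\ T (op_inv T y) = y.
Proof.
move=> [x Tx xy].
by apply: (@xgetPex _ 0 [set x | dom T x /\ T x = y]); exists x.
Qed.

Lemma inv_boundedP T : inv_bounded T ->
  [/\ forall y, dom T (op_inv T y) /\ T (op_inv T y) = y,
      forall x, dom T x -> op_inv T (T x) = x &
      exists2 M, 0 <= M & forall y, normR (op_inv T y) <= M * normR y].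
Proof.
move=> [injT [dS lS [M SM]]].
have SP y : dom T (op_inv T y) /\ T (op_inv T y) = y.
  apply: op_invP; have : dom (op_inv T) y by rewrite dS.
  by [].
split=> //.
- move=> x Tx; apply: injT; rewrite ?inE //.
  + exact: (SP _).1.
  + exact: (SP _).2.
- exists `|M| => // y; apply: (le_trans (SM y)).
  by apply: ler_wpM2r; rewrite ?normR_ge0 // ler_norm.
Qed.

Lemma inv_bounded_intro T M : linear_op T ->
  (forall y, exists2 x, dom T x & T x = y) ->
  (forall x, dom T x -> normR x <= M * normR (T x)) -> inv_bounded T.
Proof.
move=> lT sT bT.
have SP y := op_invP (sT y).
have injT x y : dom T x -> dom T y -> T x = T y -> x = y.
  move=> Tx Ty e; have [dB eB] := linear_opB lT Tx Ty.
  have := bT _ dB; rewrite eB e subrr {2}/normR normr0 mulr0 => h.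
  apply/eqP; rewrite -subr_eq0; apply/eqP/normR_eq0.
  by apply/eqP; rewrite eq_le h normR_ge0.
split; first by move=> x y; rewrite !inE; exact: injT.
have dS : dom (op_inv T) = setT by apply/seteqP; split=> // y _; exact: sT.
split=> //; last by exists M => y; have [d e] := SP y; have := bT _ d; rewrite e.
split; rewrite ?dS //.
  move=> a x y _ _; have [d1 e1] := SP (a *: x + y).
  have [d2 e2] := SP x; have [d3 e3] := SP y; have [_ h1 h2] := lT.
  apply: injT => //; first exact: h1.
  by rewrite e1 h2 // e2 e3.
Qed.

Definition total_adjoint (S S' : H -> H) := forall x y, ip (S x) y = ip x (S' y).

Lemma total_adjointC S S' : total_adjoint S S' -> total_adjoint S' S.
Proof. by move=> h x y; rewrite ipC -h -ipC. Qed.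

Lemma le_of_sqr_le_mul (a b : R) : 0 <= a -> 0 <= b -> a ^+ 2 <= a * b -> a <= b.
Proof. by rewrite le_eqVlt => /predU1P[<- //|a0 b0]; rewrite expr2 ler_pM2l. Qed.

(** With S the inverse of T: given z, the vector y with <S u, z> = <u, y> satisfies
    <T x, y> = <S (T x), z> = <x, z>, so T' y = z; and
    |y| ^ 2 = <T (S y), y> = <S y, T' y> bounds T' from below. *)
Lemma inv_bounded_adjoint T T' : linear_op T -> is_adjoint T T' ->
  inv_bounded T -> inv_bounded T' /\ total_adjoint (op_inv T) (op_inv T').
Proof.
move=> lT ad iT; have [SP ST [M M0 SM]] := inv_boundedP iT.
have [_ bS] := iT.
have iT' : inv_bounded T'.
  apply: (@inv_bounded_intro _ M (is_adjoint_linear ad)).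
    move=> z; have [y yP] := bounded_adjoint z bS.
    have /ad [Ty yz] : forall x, dom T x -> ip (T x) y = ip x z.
      by move=> x Tx; rewrite -yP ST.
    by exists y.
  move=> y Ty; have [d e] := SP y.
  apply: le_of_sqr_le_mul; rewrite ?mulr_ge0 ?normR_ge0 //.
  have : rip y y = rip (op_inv T y) (T' y).
    by rewrite -{1}e /re_ip (is_adjoint_ip ad).
  rewrite rip_norm // => ->; apply: (le_trans (rip_le ip_norm _ _)).
  by rewrite mulrA [_ * M]mulrC; apply: ler_wpM2r; rewrite ?normR_ge0.
split=> // x y; have [SP' _ _] := inv_boundedP iT'.
have [d' e'] := SP' y; have [d e] := SP x.
by rewrite -{1}e' -(is_adjoint_ip ad) // e.
Qed.

(** With S' the inverse of T': |x| ^ 2 = <x, T' (S' x)> = <T x, S' x> bounds T from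
    below, so the range of the closed operator T is closed.  A vector orthogonal
    to the range is in the kernel of T', which is trivial. *)
Lemma is_adjoint_inv_bounded T T' : linear_op T -> seq_closed_op ip T ->
  is_adjoint T T' -> inv_bounded T' -> inv_bounded T.
Proof.
move=> lT cT ad iT'; have [SP' ST' [M M0 SM]] := inv_boundedP iT'.
have bT x : dom T x -> normR x <= M * normR (T x).
  move=> Tx; have [d e] := SP' x.
  apply: le_of_sqr_le_mul; rewrite ?mulr_ge0 ?normR_ge0 //.
  have : rip x x = rip (T x) (op_inv T' x).
    by rewrite -{2}e /re_ip -(is_adjoint_ip ad).
  rewrite rip_norm // => ->; apply: (le_trans (rip_le ip_norm _ _)).
  have := ler_wpM2l (normR_ge0 (T x)) (SM x); rewrite mulrCA => h.
  by rewrite (_ : normR x * _ = M * (normR (T x) * normR x)) //; ring.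
apply: (inv_bounded_intro lT _ bT) => z.
pose D := T @` dom T.
have [T0 T00] := linear_op0 lT; have [_ lT1 lT2] := lT.
have [] := @riesz_closed D z.
- move=> a _ _ [x Tx <-] [y Ty <-]; exists (a *: x + y); first exact: lT1.
  by rewrite lT2.
- by exists 0.
(* The range is closed: bounded below, T pulls back Cauchy sequences. *)
- move=> v y Dv vy.
  have /choice [u uP] (n : nat) : exists x, dom T x /\ T x = v n.
    by have [x Tx xv] := Dv n; exists x.
  have cu : cauchy_for rip u.
    move=> e e0; have [N HN] := tends_cauchy ripP vy (div_sqrD1_gt0 M e0).
    exists N => m n Nm Nn; have [[um em] [un en]] := (uP m, uP n).
    have [d eB] := linear_opB lT um un; have := bT _ d; rewrite eB em en => h.
    exact: (rip_lt_of_normR_le ip_norm h (HN m n Nm Nn)).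
  have [x _ ux] := complete_setT ip_norm (fun=> I) cu.
  have [Tx xy] : dom T x /\ T x = y.
    apply: (cT u x y (fun n => (uP n).1) ux).
    by have -> : T \o u = v by apply/funext => n /=; exact: (uP n).2.
  by exists x.
move=> w [x Tx <-] wP; have [T'0 e'0] := linear_op0 (is_adjoint_linear ad).
have [d e] : dom T' (z - T x) /\ T' (z - T x) = 0.
  apply: (is_adjoint_rip lT ad) => y Ty; rewrite !ripE wP; last by exists y.
  by rewrite subrr /re_ip linear0r.
exists x => //; apply/esym/eqP; rewrite -subr_eq0 -(ST' _ d) e.
by have := ST' _ T'0; rewrite e'0 => ->.
Qed.

Lemma iter_total_adjoint k S S' : total_adjoint S S' ->
  total_adjoint (iter k S) (iter k S').
Proof.
move=> h; elim: k => [//|k IH] x y.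
by rewrite iterS iterSr h IH.
Qed.

Lemma op_expE T k : dom T = setT ->
  dom (op_exp T k) = setT /\ op_exp T k =1 iter k T.
Proof.
move=> dT; elim: k => [//|k [d e]]; split=> /=; last by move=> x /=; rewrite -e.
by apply/seteqP; split=> // x _ /=; rewrite -/(op_exp T k) d dT.
Qed.

(** |S' y| is the product of S' y with the unit vector x in its direction, that is
    <S x, y>, at most |S x| when |y| <= 1. *)
Lemma ubound_total_adjoint T T' : dom T = setT -> dom T' = setT ->
  total_adjoint T T' ->
  ubound [set normR (T x) | x in dom T `&` [set x | normR x <= 1]] `<=`
  ubound [set normR (T' x) | x in dom T' `&` [set x | normR x <= 1]].
Proof.
move=> dT dT' ad c cT _ [y [_ /= y1] <-].
have cP x : normR x <= 1 -> normR (T x) <= c.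
  by move=> x1; apply: cT; exists x => //; split=> //; rewrite dT.
have [z0|z0] := eqVneq (normR (T' y)) 0.
  rewrite z0; apply: (le_trans (normR_ge0 (T 0))); apply: cP.
  by rewrite /normR normr0.
have zp : 0 < normR (T' y) by rewrite lt_def z0 normR_ge0.
pose x := ((normR (T' y))^-1)%:C *: T' y.
have x1 : normR x = 1 by rewrite normRZ ?invr_ge0 ?normR_ge0 // mulVf.
have -> : normR (T' y) = rip (T x) y.
  by rewrite /re_ip ad -/(re_ip ip _ _) !ripE rip_norm // expr2 mulKf.
apply: (le_trans (rip_le ip_norm _ _)); rewrite -[leRHS]mulr1.
by apply: ler_pM; rewrite ?normR_ge0 // cP // x1.
Qed.

(** The two sets of norms have the same upper bounds, hence the same supremum, the
    default value 0 included when there are none. *)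
Lemma opnorm_total_adjoint T T' : dom T = setT -> dom T' = setT ->
  total_adjoint T T' -> opnorm T = opnorm T'.
Proof.
move=> dT dT' ad; rewrite /opnorm.
set E := [set _ | _ in _]; set E' := [set _ | _ in _].
have EE' : ubound E = ubound E'.
  by apply/seteqP; split; apply: ubound_total_adjoint => //; exact: total_adjointC.
have E0 : E !=set0.
  by exists (normR (T 0)), 0 => //; rewrite dT; split=> //=; rewrite /normR normr0.
have E'0 : E' !=set0.
  by exists (normR (T' 0)), 0 => //; rewrite dT'; split=> //=; rewrite /normR normr0.
have [[M HM]|nb] := pselect (has_ubound E); last first.
  rewrite !sup_out //; [move=> [_ [M]] | by case].
  by rewrite -EE' => HM; apply: nb; exists M.
have HM' : ubound E' M by rewrite -EE'.
apply/eqP; rewrite eq_le; apply/andP; split; apply: ge_sup => //.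
  by rewrite -/(ubound E _) EE'; apply: sup_upper_bound; split=> //; exists M.
by rewrite -/(ubound E' _) -EE'; apply: sup_upper_bound; split=> //; exists M.
Qed.

Lemma opnorm_exp_total_adjoint T T' k : dom T = setT -> dom T' = setT ->
  total_adjoint T T' -> opnorm (op_exp T k) = opnorm (op_exp T' k).
Proof.
move=> dT dT' ad; have [d e] := op_expE k dT; have [d' e'] := op_expE k dT'.
apply: opnorm_total_adjoint => // x y; rewrite e e'.
exact: iter_total_adjoint.
Qed.

End Adjoints.

(** * Closed graphs, adjoints and everywhere defined operators *)

Section Closed.
Local Open Scope complex_scope.
Variables (R : realType) (H : completeNormedModType R[i]).
Variable ip : {dot H for @Num.conj R[i]}.
Hypothesis ip_norm : forall x : H, `|x| ^+ 2 = ip x x.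
Implicit Types (x y z : H) (D : set H) (u : nat -> H) (A B T : operator H).

Local Notation rip := (re_ip ip).
Let ripP : real_form rip := rip_form ip_norm.
Let ripE := rformE ripP.

(** Symmetric in T and T', unlike [is_adjoint], so that the uniform boundedness
    argument applies to either of the two. *)
Definition formally_adjoint T T' :=
  forall x y, dom T x -> dom T' y -> rip (T x) y = rip x (T' y).

Definition bounded_on_dom T :=
  exists2 M, 0 <= M & forall x, dom T x -> normR (T x) <= M * normR x.

Lemma formally_adjointC T T' : formally_adjoint T T' -> formally_adjoint T' T.
Proof. by move=> h x y Tx Ty; rewrite (form_sym ripP) -h // (form_sym ripP). Qed.

(** The images T x of the unit ball of the domain are weakly bounded, as
    |<T x, y>| = |<x, T' y>| <= |T' y|. *)
Lemma formally_adjoint_bounded T T' : linear_op T -> formally_adjoint T T' ->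
  dom T' = setT -> bounded_on_dom T.
Proof.
move=> lT ad dT'.
have [y|M HM] := @weakly_bounded_bounded _ _ ip ip_norm
    [set s | exists x, [/\ dom T x, normR x <= 1 & T x = s]].
  exists (normR (T' y)) => _ [x [Tx x1 <-]].
  rewrite (form_sym ripP) ad ?dT' //; apply: (le_trans (rip_le ip_norm _ _)).
  by rewrite ler_piMl ?normR_ge0.
exists `|M| => // x Tx; have [x0|x0] := eqVneq (normR x) 0.
  rewrite (normR_eq0 x0) (linear_op0 lT).2.
  by rewrite /normR normr0 mulr0.
have xp : 0 < normR x by rewrite lt_def x0 normR_ge0.
have [Tr Tre] := linear_opZ ((normR x)^-1)%:C lT Tx.
have /HM : [set s | exists x, [/\ dom T x, normR x <= 1 & T x = s]]
    (((normR x)^-1)%:C *: T x).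
  exists (((normR x)^-1)%:C *: x); split=> //.
  by rewrite normRZ ?invr_ge0 ?normR_ge0 // mulVf.
rewrite normRZ ?invr_ge0 ?normR_ge0 // mulrC => h.
by rewrite -ler_pdivrMr //; apply: le_trans (ler_norm M).
Qed.

Lemma is_adjoint_formally T T' : is_adjoint ip T T' -> formally_adjoint T T'.
Proof. by move=> ad x y Tx Ty; rewrite /re_ip (is_adjoint_ip ad). Qed.

Lemma form_eq_lim x x' y z u v : tends rip u y -> tends rip v z ->
  (forall n, rip x (u n) = rip x' (v n)) -> rip x y = rip x' z.
Proof.
move=> uy vz uv; pose d := rip x y - rip x' z.
have main (e : R) : 0 < e -> d ^+ 2 <= e * (2 * rip x x + 2 * rip x' x').
  move=> e0; have [N1 H1] := uy e e0; have [N2 H2] := vz e e0.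
  have {H1} := H1 _ (leq_maxl N1 N2); have {H2} := H2 _ (leq_maxr N1 N2).
  set n := maxn _ _ => h2 h1.
  have := form_CS ripP x (u n - y); have := form_CS ripP x' (v n - z).
  have {d}-> : d = rip x' (v n - z) - rip x (u n - y).
    by rewrite /d !ripE uv; ring.
  move: (u n - y) (v n - z) h1 h2 => a b h1 h2 c2 c1.
  have := form_ge0 ripP x; have := form_ge0 ripP x' => p1 p2.
  have e1 := ler_wpM2l p1 (ltW h2); have e2 := ler_wpM2l p2 (ltW h1).
  by have := sqr_ge0 (rip x' b + rip x a); nra.
have d0 : d ^+ 2 <= 0.
  apply/ler_addgt0Pr => e e0; rewrite add0r.
  pose K := 2 * rip x x + 2 * rip x' x'.
  have K0 : 0 < K + 1.
    by have := form_ge0 ripP x; have := form_ge0 ripP x'; rewrite /K; lra.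
  apply: (le_trans (main _ (divr_gt0 e0 K0))); rewrite -/K.
  by rewrite mulrAC ler_pdivrMr // ler_pM2l // lerDl.
apply/eqP; rewrite -subr_eq0 -/d -sqrf_eq0.
by rewrite eq_le d0 sqr_ge0.
Qed.

Lemma adjoint_seq_closed_op T T' : linear_op T -> is_adjoint ip T T' ->
  seq_closed_op ip T'.
Proof.
move=> lT ad u y z Tu uy uz.
apply: (is_adjoint_rip lT ad) => x Tx.
apply: (form_eq_lim uy uz) => n /=.
by rewrite (is_adjoint_formally ad).
Qed.

Lemma bounded_cauchy T u : linear_op T -> bounded_on_dom T ->
  (forall n, dom T (u n)) -> cauchy_for rip u -> cauchy_for rip (T \o u).
Proof.
move=> lT [M _ bT] Tu cu e e0; have [N HN] := cu _ (div_sqrD1_gt0 M e0).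
exists N => m n Nm Nn.
have [d eB] := linear_opB lT (Tu m) (Tu n); have := bT _ d; rewrite eB => h.
exact: (rip_lt_of_normR_le ip_norm h (HN m n Nm Nn)).
Qed.

Lemma bounded_seq_closed_dom T : linear_op T -> seq_closed_op ip T ->
  bounded_on_dom T -> seq_closed ip (dom T).
Proof.
move=> lT cT bT u x Tu ux.
have cu := bounded_cauchy lT bT Tu (tends_cauchy ripP ux).
have [y _ uy] := complete_setT ip_norm (fun=> I) cu.
exact: (cT _ _ _ Tu ux uy).1.
Qed.

Lemma tends_uniq u x y : tends rip u x -> tends rip u y -> x = y.
Proof.
move=> ux uy; apply: (@ip_inj _ _ ip) => z.
apply: (ip_of_rip (l := fun z => ip z x) (D := setT)) => // [w _|w _].
  by rewrite linearZl_LR.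
exact: (form_eq_lim ux uy).
Qed.

(** T need not be closed: if u n in D(T) tends to x, then T (u n) is Cauchy, with a
    limit y, and u n, the image of T (u n) under the bounded inverse, tends to
    the image of y, which is in D(T). *)
Lemma inv_bounded_seq_closed_dom T : linear_op T -> inv_bounded T ->
  bounded_on_dom T -> seq_closed ip (dom T).
Proof.
move=> lT iT bT u x Tu ux.
have cu := bounded_cauchy lT bT Tu (tends_cauchy ripP ux).
have [y _ uy] := complete_setT ip_norm (fun=> I) cu.
have [SP ST [K K0 SK]] := inv_boundedP iT.
suff -> : x = op_inv T y by exact: (SP y).1.
apply: (tends_uniq ux) => e e0.
have [N HN] := uy _ (div_sqrD1_gt0 K e0).
exists N => n /HN; have [d eq] := SP y.
have [d' eq'] := linear_opB lT (Tu n) d.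
have := SK (T (u n) - y); rewrite -{1}eq -eq' ST // => h.
exact: (rip_lt_of_normR_le ip_norm h).
Qed.

Lemma dom_full_of_orth T : linear_op T -> seq_closed ip (dom T) ->
  (forall z, (forall x, dom T x -> rip x z = 0) -> z = 0) -> dom T = setT.
Proof.
move=> [T0 TP _] cT orth; apply/seteqP; split=> // z _.
have [w Tw wP] := riesz_closed ip_norm z TP T0 cT.
suff -> : z = w by [].
apply/eqP; rewrite -subr_eq0; apply/eqP/orth => x Tx.
by rewrite !ripE wP // subrr.
Qed.

(** The domain of the adjoint of a closed operator is dense (von Neumann).  The
    orthogonal projection of (0, z) onto the graph of T is a pair (x, T x) with
    <w, x> + <T w, T x> = <T w, z> for w in D(T), so z - T x is in D(T') and
    T' (z - T x) = x.  If z is orthogonal to D(T'), then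
    |z - T x| ^ 2 = - <T x, z - T x> = - |x| ^ 2, so x = 0 and z = T x = 0. *)
Lemma dom_adjoint_orth0 T T' z : linear_op T -> seq_closed_op ip T ->
  is_adjoint ip T T' -> (forall y, dom T' y -> rip y z = 0) -> z = 0.
Proof.
move=> lT cT ad zP.
pose V : lmodType R[i] := (H * H)%type.
pose g (p q : V) : R := rip p.1 q.1 + rip p.2 q.2.
pose G : set V := [set p | dom T p.1 /\ T p.1 = p.2].
have gP : real_form g.
  split.
  - by move=> p q; rewrite /g (form_sym ripP p.1) (form_sym ripP p.2).
  - by move=> a p q r; rewrite /g /= !ripE; ring.
  - by move=> p; rewrite /g addr_ge0 // (form_ge0 ripP).
have [T0 TP TL] := lT.
have GP : real_subspace G.
  split; first by split=> //=; exact: (linear_op0 lT).2.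
  move=> a [x1 x2] [y1 y2] [/= Tx <-] [/= Ty <-]; split=> /=; first exact: TP.
  exact: TL.
have cG : complete_for g G.
  move=> u Gu cu.
  have sub1 p : rip p.1 p.1 <= g p p by rewrite /g lerDl (form_ge0 ripP).
  have sub2 p : rip p.2 p.2 <= g p p by rewrite /g lerDr (form_ge0 ripP).
  have c1 : cauchy_for rip (fun n => (u n).1).
    move=> e /cu [N HN]; exists N => m n Nm Nn.
    exact: le_lt_trans (sub1 (u m - u n)) (HN m n Nm Nn).
  have c2 : cauchy_for rip (fun n => (u n).2).
    move=> e /cu [N HN]; exists N => m n Nm Nn.
    exact: le_lt_trans (sub2 (u m - u n)) (HN m n Nm Nn).
  have [x _ ux] := complete_setT ip_norm (fun=> I) c1.
  have [y _ uy] := complete_setT ip_norm (fun=> I) c2.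
  exists ((x, y) : V).
    apply: (cT _ _ _ (fun n => (Gu n).1) ux).
    by have -> : T \o (fun n => (u n).1) = (fun n => (u n).2)
      by apply/funext => n /=; exact: (Gu n).2.
  move=> e e0; have [N1 H1] := ux (e / 2) ltac:(lra).
  have [N2 H2] := uy (e / 2) ltac:(lra).
  exists (maxn N1 N2) => n; rewrite geq_max => /andP[/H1 h1 /H2 h2].
  by rewrite /g /=; lra.
have [||[x y] [/= Tx <-] xP] :=
    riesz_representation (l := fun p : V => rip p.2 z) (M := rip z z) gP GP cG.
- by move=> a p q _ _; rewrite /= !ripE.
- move=> p _; have := form_ge0 ripP (p.2 - z); have := form_ge0 ripP p.1.
  by rewrite /g !ripE (form_sym ripP z) => *; lra.
have [d e] : dom T' (z - T x) /\ T' (z - T x) = x.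
  apply: (is_adjoint_rip lT ad) => w Tw.
  have := xP (w, T w) (conj Tw erefl).
  by rewrite /g /= !ripE => ->; rewrite addrK.
have h1 := zP _ d.
have h2 := is_adjoint_formally ad Tx d; rewrite e in h2.
have hx := form_ge0 ripP x; have hz := form_ge0 ripP (z - T x).
rewrite !ripE (form_sym ripP z (T x)) in h1 h2 hz.
have x0 : x = 0.
  apply: normR_eq0; apply/eqP; rewrite -sqrf_eq0 -(rip_norm ip_norm).
  by apply/eqP; lra.
move: h1; rewrite x0 (linear_op0 lT).2 (rform0l ripP) subr0.
by rewrite rip_norm // => /eqP; rewrite sqrf_eq0 => /eqP /normR_eq0.
Qed.

(** Closed graph theorem, from D(B) or from D(B').  An everywhere defined member of
    the adjoint pair bounds the other one on its domain, which is then closed;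
    it is dense, so the other one is everywhere defined as well. *)
Lemma bounded_of_full_dom B B' : linear_op B -> closed_op B -> dense (dom B) ->
  is_adjoint ip B B' -> dom B = setT \/ dom B' = setT -> bounded_op B.
Proof.
move=> lB clB dB ad full; have cB := closed_seq_closed_op ip_norm clB.
have lB' := is_adjoint_linear ad; have cB' := adjoint_seq_closed_op lB ad.
have fa := is_adjoint_formally ad.
have fB' : dom B' = setT.
  case: full => // fB; apply: dom_full_of_orth => //; last first.
    by move=> z; exact: (dom_adjoint_orth0 lB cB ad).
  apply: bounded_seq_closed_dom => //.
  exact: (formally_adjoint_bounded lB' (formally_adjointC fa)).
have bB := formally_adjoint_bounded lB fa fB'.
have fB : dom B = setT.
  apply: dom_full_of_orth => //; last by move=> z; exact: (dense_orth ip_norm dB).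
  exact: bounded_seq_closed_dom.
split=> //; have [M _ h] := bB; exists M => x.
by apply: h; rewrite fB.
Qed.

End Closed.

(** * Pencils and their pseudospectra *)

Section Pencil.
Variables (R : realType) (H : completeNormedModType R[i]).
Variable ip : {dot H for @Num.conj R[i]}.
Hypothesis ip_norm : forall x : H, `|x| ^+ 2 = ip x x.
Implicit Types (x y z : H) (D : set H) (u : nat -> H) (A B T : operator H).
Implicit Types (lambda : R[i]).

Local Notation rip := (re_ip ip).

Lemma pencil_linear A B lambda : linear_op A -> linear_op B ->
  linear_op (pencil A B lambda).
Proof.
move=> [A0 A1 A2] [B0 B1 B2]; split=> //.
- by move=> a x y [Ax Bx] [Ay By]; split; [exact: A1 | exact: B1].
- move=> a x y [Ax Bx] [Ay By] /=; rewrite A2 // B2 // scalerDr scalerBr !scalerA.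
  by rewrite opprD addrACA [a * _]mulrC.
Qed.

Lemma tends_comb (a b : R[i]) u v x y : tends rip u x -> tends rip v y ->
  tends rip (fun n => a *: u n + b *: v n) (a *: x + b *: y).
Proof.
move=> /(tends_cvg ip_norm) ux /(tends_cvg ip_norm) vy; apply: (cvg_tends ip_norm).
by apply: cvgD; exact: cvgZr.
Qed.

Lemma bounded_tends A u x : bounded_op A -> tends rip u x ->
  tends rip (A \o u) (A x).
Proof.
move=> [dA lA [M AM]] ux e e0; have [N HN] := ux _ (div_sqrD1_gt0 M e0).
exists N => n /HN.
have dAx w : dom A w by rewrite dA.
have [_ eB] := linear_opB lA (dAx (u n)) (dAx x).
have := AM (u n - x); rewrite eB => h.
exact: (rip_lt_of_normR_le ip_norm h).
Qed.

Lemma pencil_ip A B A' B' lambda x y : is_adjoint ip A A' -> is_adjoint ip B B' ->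
  dom (pencil A B lambda) x -> dom (pencil A' B' lambda^*) y ->
  ip (pencil A B lambda x) y = ip x (pencil A' B' lambda^* y).
Proof.
move=> aA aB [Ax Bx] [Ay By] /=.
rewrite linearBl linearBr /= linearZl_LR linearZr_LR /= conjCK.
by rewrite (is_adjoint_ip aA) // (is_adjoint_ip aB).
Qed.

Lemma bounded_is_adjoint_full A A' :
  bounded_op A -> is_adjoint ip A A' -> dom A' = setT.
Proof.
move=> bA aA; apply/seteqP; split=> // y _.
have [z zP] := bounded_adjoint ip_norm y bA.
by apply: ((aA y z).2 _).1 => x _.
Qed.

(** On D(A) one has A = lambda B - T, and B has an everywhere defined adjoint; so
    being in the domain of the adjoint of T and being in that of the adjoint of
    A are equivalent. *)
Lemma pencil_adjoint_boundedB A B A' B' lambda : bounded_op B ->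
  is_adjoint ip A A' -> is_adjoint ip B B' ->
  is_adjoint ip (pencil A B lambda) (pencil A' B' lambda^*).
Proof.
move=> bB aA aB y z; have fB' := bounded_is_adjoint_full bB aB.
have fB : dom B = setT by case: bB.
split=> [[Ty <-] x Tx|h]; first exact: pencil_ip.
have B'y : dom B' y by rewrite fB'.
have /aA [A'y e] : forall x, dom A x -> ip (A x) y = ip x (lambda^* *: B' y - z).
  move=> x Ax; have Bx : dom B x by rewrite fB.
  have := h x (conj Ax Bx); rewrite linearBl /= linearZl_LR /= => hx.
  rewrite linearBr /= linearZr_LR /= conjCK -(is_adjoint_ip aB) // -hx.
  by rewrite opprB addrC subrK.
by split=> //=; rewrite e opprB addrC subrK.
Qed.

(** The same argument on D(B), with B = lambda^-1 (T + A); for lambda = 0 the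
    pencil says nothing about B on its domain. *)
Lemma pencil_adjoint_boundedA A B A' B' lambda : bounded_op A -> lambda != 0 ->
  is_adjoint ip A A' -> is_adjoint ip B B' ->
  is_adjoint ip (pencil A B lambda) (pencil A' B' lambda^*).
Proof.
move=> bA l0 aA aB y z; have fA' := bounded_is_adjoint_full bA aA.
have fA : dom A = setT by case: bA.
split=> [[Ty <-] x Tx|h]; first exact: pencil_ip.
have A'y : dom A' y by rewrite fA'.
have /aB [B'y e] : forall x, dom B x ->
    ip (B x) y = ip x ((lambda^-1)^* *: (z + A' y)).
  move=> x Bx; have Ax : dom A x by rewrite fA.
  have := h x (conj Ax Bx); rewrite linearBl /= linearZl_LR /= => hx.
  rewrite linearZr_LR /= conjCK linearDr /= -(is_adjoint_ip aA) // -hx.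
  by rewrite subrK mulKf.
split=> //=; rewrite e scalerA -rmorphM /= mulfV // rmorph1 scale1r addrK //.
Qed.

Lemma pencil_closed_boundedB A B lambda : bounded_op B -> seq_closed_op ip A ->
  seq_closed_op ip (pencil A B lambda).
Proof.
move=> bB cA u x y Tu ux uy.
have h := tends_comb lambda (-1) (bounded_tends bB ux) uy.
have [Ax e] : dom A x /\ A x = lambda *: B x + -1 *: y.
  apply: (cA _ _ _ (fun n => (Tu n).1) ux).
  have -> : A \o u =
      fun n => lambda *: (B \o u) n + -1 *: (pencil A B lambda \o u) n.
    by apply/funext => n /=; rewrite scaleN1r opprB addrC subrK.
  exact: h.
have fB : dom B = setT by case: bB.
split; first by rewrite /= fB.
by rewrite /= e scaleN1r opprB addrC subrK.
Qed.

Lemma pencil_closed_boundedA A B lambda : bounded_op A -> lambda != 0 ->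
  seq_closed_op ip B -> seq_closed_op ip (pencil A B lambda).
Proof.
move=> bA l0 cB u x y Tu ux uy.
have h := tends_comb lambda^-1 lambda^-1 uy (bounded_tends bA ux).
have [Bx e] : dom B x /\ B x = lambda^-1 *: y + lambda^-1 *: A x.
  apply: (cB _ _ _ (fun n => (Tu n).2) ux).
  have -> : B \o u =
      fun n => lambda^-1 *: (pencil A B lambda \o u) n + lambda^-1 *: (A \o u) n.
    by apply/funext => n /=; rewrite -scalerDr subrK scalerA mulVf // scale1r.
  exact: h.
have fA : dom A = setT by case: bA.
split; first by rewrite /= fA.
by rewrite /= e -scalerDr scalerA mulfV // scale1r addrK.
Qed.

(** For lambda = 0 and A bounded, the pencil need not be closed, and its adjoint can
    be larger than the pencil of the adjoints.  In that case, a bounded inverse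
    of either pencil makes B bounded. *)
Lemma pencil_inv_bounded A B A' B' lambda :
  linear_op A -> linear_op B -> closed_op A -> closed_op B ->
  dense (dom B) -> is_adjoint ip A A' -> is_adjoint ip B B' ->
  bounded_op A \/ bounded_op B ->
  (inv_bounded (pencil A B lambda) <-> inv_bounded (pencil A' B' lambda^*)) /\
  (inv_bounded (pencil A B lambda) -> total_adjoint ip
    (op_inv (pencil A B lambda)) (op_inv (pencil A' B' lambda^*))).
Proof.
move=> lA lB clA clB dB aA aB bAB.
have cA := closed_seq_closed_op ip_norm clA.
have cB := closed_seq_closed_op ip_norm clB.
have lT := pencil_linear lambda lA lB.
set T := pencil A B lambda; set T' := pencil A' B' _.
have resolvent_adjoint : is_adjoint ip T T' -> seq_closed_op ip T ->
  (inv_bounded T <-> inv_bounded T') /\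
  (inv_bounded T -> total_adjoint ip (op_inv T) (op_inv T')).
  move=> ad cT; split; last by move=> /(inv_bounded_adjoint ip_norm lT ad) [].
  split; last exact: (is_adjoint_inv_bounded ip_norm lT cT ad).
  by move=> /(inv_bounded_adjoint ip_norm lT ad) [].
have resolvent_adjointB : bounded_op B -> (inv_bounded T <-> inv_bounded T') /\
  (inv_bounded T -> total_adjoint ip (op_inv T) (op_inv T')).
  move=> bB; apply: resolvent_adjoint; first exact: pencil_adjoint_boundedB.
  exact: pencil_closed_boundedB.
case: bAB => [bA|//].
have [l0|l0] := eqVneq lambda 0; last first.
  apply: resolvent_adjoint; first exact: pencil_adjoint_boundedA.
  exact: pencil_closed_boundedA.
have lA' := is_adjoint_linear aA; have lB' := is_adjoint_linear aB.
have lT' : linear_op T' by exact: pencil_linear.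
have fA : dom A = setT by case: bA.
have fA' := bounded_is_adjoint_full bA aA.
have faA := is_adjoint_formally aA.
have bT : bounded_on_dom T.
  have [M M0 bM] := formally_adjoint_bounded ip_norm lA faA fA'.
  exists M => // x [Ax Bx]; rewrite /T /= l0 scale0r sub0r /normR normrN.
  exact: bM.
have bT' : bounded_on_dom T'.
  have [M M0 bM] := formally_adjoint_bounded ip_norm lA'
    (formally_adjointC ip_norm faA) fA.
  exists M => // x [Ax Bx]; rewrite /T' /= l0 conjC0 scale0r sub0r /normR normrN.
  exact: bM.
have dT : dom T = dom B by rewrite /T /= fA setTI.
have dT' : dom T' = dom B' by rewrite /T' /= fA' setTI.
have fullB : inv_bounded T -> bounded_op B.
  move=> iT; apply: (bounded_of_full_dom ip_norm lB clB dB aB); left.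
  apply: (dom_full_of_orth ip_norm lB); last first.
    by move=> z; exact: (dense_orth ip_norm dB).
  by rewrite -dT; exact: (inv_bounded_seq_closed_dom ip_norm lT iT bT).
have fullB' : inv_bounded T' -> bounded_op B.
  move=> iT; apply: (bounded_of_full_dom ip_norm lB clB dB aB); right.
  apply: (dom_full_of_orth ip_norm lB'); last first.
    by move=> z; exact: (dom_adjoint_orth0 ip_norm lB cB aB).
  by rewrite -dT'; exact: (inv_bounded_seq_closed_dom ip_norm lT' iT bT').
split; last by move=> iT; apply: (resolvent_adjointB (fullB iT)).2.
split=> iT; first by apply/(resolvent_adjointB (fullB iT)).1.
by apply/(resolvent_adjointB (fullB' iT)).1.
Qed.

Lemma pseudospectrum_adjoint A B n (epsilon : R) :
  linear_op A -> linear_op B -> closed_op A -> closed_op B ->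
  dense (dom A) -> dense (dom B) -> bounded_op A \/ bounded_op B ->
  pseudospectrum_n n epsilon A B =
    conj_set (pseudospectrum_n n epsilon (adjoint ip A) (adjoint ip B)).
Proof.
move=> lA lB clA clB dA dB bAB.
have aA := adjointP ip_norm dA; have aB := adjointP ip_norm dB.
suff main lambda : pseudospectrum_n n epsilon A B lambda <->
    pseudospectrum_n n epsilon (adjoint ip A) (adjoint ip B) lambda^*.
  apply/seteqP; split=> lambda.
    by move=> /main h; exists lambda^* => //; rewrite conjCK.
  by move=> [mu h <-]; apply/main; rewrite conjCK.
have [iff tot] := pencil_inv_bounded lambda lA lB clA clB dB aA aB bAB.
rewrite /pseudospectrum_n /spectrum /=.
have eqn : inv_bounded (pencil A B lambda) ->
  opnorm (op_exp (op_inv (pencil A B lambda)) (2 ^ n)%N) =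
  opnorm (op_exp (op_inv (pencil (adjoint ip A) (adjoint ip B) lambda^*)) (2 ^ n)%N).
  move=> i1; apply: (opnorm_exp_total_adjoint ip_norm _ _ _ (tot i1)).
    by case: i1 => _ [].
  by case: (iff.1 i1) => _ [].
have [i1|ni] := pselect (inv_bounded (pencil A B lambda)).
  split=> -[h|h].
  - by case: h.
  - by right; rewrite /= -eqn.
  - by case: h; exact/iff.
  - by right; rewrite /= eqn.
by split=> _; left => // /iff.
Qed.

End Pencil.

Theorem theorem2p9 (R : realType) (H : completeNormedModType R[i])
    (ip : {dot H for @Num.conj R[i]})
    (ip_norm : forall x : H, `|x| ^+ 2 = ip x x)
    (A B : operator H)
    (linA : linear_op A) (linB : linear_op B)
    (clA : closed_op A) (clB : closed_op B)
    (dA : dense (dom A)) (dB : dense (dom B))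
    (dAB : dense (dom (op_add A B))) (dAcB : dense (dom (op_comp A B)))
    (n : nat) (epsilon : R) (eps0 : 0 < epsilon) :
  (bounded_op A \/ bounded_op B ->
     pseudospectrum epsilon A B =
       conj_set (pseudospectrum epsilon (adjoint ip A) (adjoint ip B))) /\
  (bounded_op A -> bounded_op B ->
     pseudospectrum_n n epsilon A B =
       conj_set (pseudospectrum_n n epsilon (adjoint ip A) (adjoint ip B))).
Proof.
split=> [bAB|bA _]; first exact: pseudospectrum_adjoint.
by apply: pseudospectrum_adjoint => //; left.
Qed.
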